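(* Let $\Gamma$ be an infinite group generated by a finite symmetric set $S = S^{-1} \subset \Gamma$, with growth function $\gamma_S$. (I) Suppose that $\gamma_S(n-1) \geq C n^d$ for some real constants $C > 0$ and $d \geq 1$ and every integer $n \geq 1$. Then $$\operatorname{Card}(\partial_S D) \geq \frac{C^{\frac{1}{d}}\, d}{(d+1)^{\frac{d+1}{d}}} \operatorname{Card}(D)^{\frac{d-1}{d}}$$ for every non-empty finite subset $D \subset \Gamma$. (II) Suppose that $\gamma_S(n-1) \geq C e^{b n^{\alpha}}$ for some real constants $C > 0$, $b > 0$ and $0 < \alpha \leq 1$ and every integer $n \geq 1$. Then $$\operatorname{Card}(\partial_S D) \geq \mu(\operatorname{Card}(D)) \cdot \frac{\operatorname{Card}(D)}{\left(\frac{1}{b} \log(\operatorname{Card}(D))\right)^{1/\alpha}}$$ for every finite subset $D \subset \Gamma$ with $\operatorname{Card}(D) \geq 2$, where, for real $v \geq 2$, $$\mu(v) = \left(1 - \frac{1}{\lambda(v)}\right)\left(1 + \frac{\log(\lambda(v)) - \log(C)}{\log(v)}\right)^{-1/\alpha}, \qquad \lambda(v) = -\alpha\, W_{-1}\!\left(-\frac{C e^{-1/\alpha}}{\alpha v}\right),$$ and this function satisfies $\mu(v) \to 1$ as $v \to \infty$.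
   Context: $\mathbb{N}$ denotes the non-negative integers (including $0$). For a group $\Gamma$ with identity $e$ generated by a finite symmetric set $S = S^{-1}$, $B_S(n) \subset \Gamma$ is the set of elements that can be written as a product of at most $n$ generators in $S$ (so $B_S(0) = \{e\}$). The growth function is $\gamma_S(n) = \operatorname{Card}(B_S(n))$ for $n \in \mathbb{N}$. The boundary of a non-empty finite subset $D \subset \Gamma$ is $$\partial_S D = \{x \in D \mid \exists s \in S \text{ such that } sx \notin D\}.$$ $W_{-1} : [-\frac{1}{e}, 0) \to (-\infty, -1]$ is the branch of the Lambert function determined by $W_{-1}(x)\exp(W_{-1}(x)) = x$. Equivalently, $\lambda = \lambda(v)$ is the unique solution in $[\alpha, \infty)$ of $v = \frac{C}{\lambda} e^{(\lambda - 1)/\alpha}$. $\log$ is the natural logarithm. *)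

(* Defs.v *)
From HB Require Import structures.
From mathcomp Require Import all_boot all_order all_algebra.
From mathcomp Require Import finmap.
From mathcomp Require Import all_classical all_reals all_analysis.
Set Implicit Arguments.
Unset Strict Implicit.
Unset Printing Implicit Defensive.
Import Order.TTheory GRing.Theory Num.Theory.
Import numFieldNormedType.Exports.
Local Open Scope classical_set_scope.
Local Open Scope fset_scope.
Local Open Scope ring_scope.

Section Growth.
Variable Gamma : groupType.
Implicit Types (S D : {fset Gamma}) (n : nat) (x : Gamma).

Definition symmetric_fset S : Prop := S = [fset (s^-1)%g | s in S].

(* Under the classical axioms in scope, every subset of [Gamma] is a boolean
   predicate, so [H] ranges over all subgroups containing [S]. *)
Definition generates S : Prop :=
  forall H : {pred Gamma}, group_closed H -> {subset S <= H} ->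
    forall x, x \in H.

Definition word_ball S n : set Gamma :=
  [set x | exists w : seq Gamma,
     [/\ (size w <= n)%N, {subset w <= S} & x = (\prod_(s <- w) s)%g]].

Lemma finite_word_ball S n : finite_set (word_ball S n).
Proof.
elim: n => [|n IHn].
  apply: (sub_finite_set _ (finite_set1 1%g)) => x [[|s w] [//= _ _ ->]].
  by rewrite big_nil.
have fS : finite_set ([set` S]) by exact: finite_fset.
apply: (@sub_finite_set _ _
  ([set 1%g] `|` [set (s * y)%g | s in [set` S] & y in word_ball S n])); last first.
  by rewrite finite_setU; split; [exact: finite_set1 | exact: finite_image2].
move=> x [[|s w] [/= ltwn wS ->]]; first by left; rewrite big_nil.
right; rewrite big_cons; exists s; first by apply: wS; rewrite mem_head.
exists (\prod_(t <- w) t)%g => //; exists w; split=> // t tw.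
by apply: wS; rewrite inE tw orbT.
Qed.

(* [fset_set] is meaningful here by [finite_word_ball]. *)
Definition growth S n : nat := #|` fset_set (word_ball S n)|.

Definition boundary S D : {fset Gamma} :=
  [fset x in D | [exists s : S, (fsval s * x)%g \notin D]].

End Growth.

Section Lambert.
Variable R : realType.
Implicit Types (C alpha v x : R).

(* For [- e^-1 <= x < 0], this is the unique [w <= -1] with [w * e^w = x];
   the value [0] outside that range is a placeholder. *)
Definition lambertWm1 x : R :=
  xget 0 [set w : R | w <= -1 /\ w * expR w = x].

Definition lambda_of C alpha v : R :=
  - alpha * lambertWm1 (- (C * expR (- alpha^-1) / (alpha * v))).

Definition mu_of C alpha v : R :=
  (1 - 1 / lambda_of C alpha v) *
  (1 + (ln (lambda_of C alpha v) - ln C) / ln v) `^ (- (1 / alpha)).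

End Lambert.

(* Main.v *)
Require Import Defs.
From HB Require Import structures.
From mathcomp Require Import all_boot all_order all_algebra.
From mathcomp Require Import finmap.
From mathcomp Require Import all_classical all_reals all_analysis.
From mathcomp Require Import ring lra.
Set Implicit Arguments.
Unset Strict Implicit.
Unset Printing Implicit Defensive.
Import Order.TTheory GRing.Theory Num.Theory.
Import numFieldNormedType.Exports.
Local Open Scope classical_set_scope.
Local Open Scope fset_scope.
Local Open Scope ring_scope.

(** The proof compares two estimates of how much of [D] left multiplication by
    a typical element of the ball of radius [n] moves out of [D].

    Moving along a word of length at most [n] one letter at a time, a point of
    [D] that ends outside must cross the boundary at some letter, so each
    element of the ball expels at most [n * #|boundary S D|] points
    ([card_displaced_word]).  On the other hand a point [x] of [D] is kept
    inside by at most [#|D|] elements, since [g] is determined by [g * x]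
    ([sum_card_kept]).  Averaging over the ball gives, for every real [r > 0]
    and every positive lower bound [T] of the cardinality of the ball of radius
    [truncn r],
      (1 - #|D| / T) * #|D| / r <= #|boundary S D|
    ([boundary_radius]).  The growth hypothesis at [truncn r + 1], which exceeds
    [r], shows that [T] may be taken to be the value at the real number [r]
    itself of the assumed lower bound, so that no rounding is lost.

    For polynomial growth the best radius is the one where
    [T = (d + 1) * #|D|].  For exponential growth one takes [T = lambda * #|D|]
    with [lambda = lambda_of C alpha #|D|]; solving
    [C * expR (b * r `^ alpha) = T] for [r] makes the left-hand side exactly
    the quantity involving [mu_of].  What is needed of [lambda] is the equation
    [lambda * v = C * expR ((lambda - 1) / alpha)] and [1 < lambda]
    ([lambda_ofP]).

    For the limit, that equation expresses [ln v] through [lambda], so [mu_of]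
    becomes a function of [lambda] alone in which only [lambda^-1] and
    [ln lambda / lambda] occur; both vanish because [lambda] tends to infinity
    with [v]. *)

(** * Displacement and boundary *)

Lemma card_fset_sep (T : choiceType) (A : {fset T}) (P : pred T) :
  #|` [fset x in A | P x]| = (\sum_(x <- A) P x)%N.
Proof.
by rewrite card_fset_sum1 -big_fset_condE /= big_mkcond.
Qed.

(** A point of [D] leaving [D] under [s * p] either already leaves under [p], or
    [p] carries it to a boundary point; as translation by [p] is injective, each
    letter accounts for at most [#|boundary S D|] points. *)
Lemma card_displaced_word (Gamma : groupType) (S D : {fset Gamma})
    (w : seq Gamma) : {subset w <= S} ->
  (#|` [fset x in D | ((\prod_(s <- w) s) * x)%g \notin D]|
     <= size w * #|` boundary S D|)%N.
Proof.
elim: w => [_|s w IHw wS].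
  rewrite mul0n leqn0 cardfs_eq0; apply/eqP/fsetP => x.
  by rewrite !inE big_nil mul1g andbN.
set p := (\prod_(t <- w) t)%g.
have sS : s \in S by apply: wS; rewrite mem_head.
apply: (@leq_trans (#|` [fset (p^-1 * y)%g | y in boundary S D]
    `|` [fset x in D | (p * x)%g \notin D]|)); last first.
  apply: leq_trans (leq_card_fsetU _ _) _; rewrite mulSn leq_add //.
    exact: leq_imfset_card.
  by apply: IHw => t tw; apply: wS; rewrite inE tw orbT.
apply: fsubset_leq_card; apply/fsubsetP => x.
rewrite !inE big_cons -/p -mulgA => /andP[xD spxD].
case: (boolP ((p * x)%g \in D)) => pxD; last by rewrite xD orbT.
apply/orP; left; apply/imfsetP; exists (p * x)%g; last by rewrite mulKg.
rewrite /= !inE pxD /=; apply/existsP; by exists [` sS].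
Qed.

(** Exchanging the summations, each [x] contributes the number of [g] with
    [g * x] in [D], and [g] is recovered from [g * x]. *)
Lemma sum_card_kept (Gamma : groupType) (A D : {fset Gamma}) :
  (\sum_(g <- A) #|` [fset x in D | (g * x)%g \in D]| <= #|` D| * #|` D|)%N.
Proof.
under eq_bigr do rewrite card_fset_sep.
rewrite exchange_big /= [X in (_ <= _ * X)%N]card_fset_sum1 big_distrr /=.
rewrite big_seq [leqRHS]big_seq; apply: leq_sum => x _; rewrite muln1.
rewrite -card_fset_sep.
set B := [fset g in A | _].
have <- : #|` [fset (g * x)%g | g in B]| = #|` B| by apply/card_imfset/mulIg.
apply: fsubset_leq_card; apply/fsubsetP => y /imfsetP[g /=].
by rewrite !inE => /andP[_ gxD] ->.
Qed.

(** The two counts are summed over the ball, each element splitting [D] into the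
    points that it keeps inside and those that it expels; the inequality is
    free of subtraction and division so that it lives in [nat]. *)
Lemma growth_boundary (Gamma : groupType) (S D : {fset Gamma}) (n : nat) :
  (growth S n * #|` D|
    <= #|` D| * #|` D| + growth S n * (n * #|` boundary S D|))%N.
Proof.
rewrite /growth; set A := fset_set _.
apply: leq_trans (leq_add (sum_card_kept A D) (leqnn _)).
rewrite card_fset_sum1 !big_distrl -big_split /=.
rewrite big_seq [leqRHS]big_seq; apply: leq_sum => g; rewrite !mul1n.
rewrite in_fset_set; last exact: finite_word_ball.
rewrite inE => -[w [wn wS ->]].
set p := (\prod_(t <- w) t)%g.
rewrite -(cardfsID [fset x in D | (p * x)%g \in D] D) leq_add //.
  by apply: fsubset_leq_card; apply: fsubsetIr.
apply: leq_trans (leq_mul wn (leqnn _)).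
apply: leq_trans (card_displaced_word _ wS).
apply: fsubset_leq_card; apply/fsubsetP => x; rewrite !inE -/p.
by case: (x \in D); rewrite /= ?andbT ?andbF.
Qed.

(** Freeing the radius from integrality leaves only an optimisation in [r]:
    replacing the integral radius by the larger [r], and the growth by its
    lower bound [T], both weaken the estimate. *)
Lemma boundary_radius (R : realType) (Gamma : groupType) (S D : {fset Gamma})
    (r T : R) : 0 < r -> 0 < T -> T <= (growth S (Num.truncn r))%:R ->
  (1 - #|` D|%:R / T) * #|` D|%:R / r <= #|` boundary S D|%:R.
Proof.
move=> r0 T0 Tg; rewrite ler_pdivrMr //.
set n := Num.truncn r in Tg *; set B := #|` boundary S D|; set v := #|` D|.
have nr : n%:R <= r by have /andP[] := truncn_itv (ltW r0).
have := growth_boundary S D n; rewrite -/B -/v -(ler_nat R) natrD !natrM.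
set g : R := (growth S n)%:R in Tg *; move=> H.
have g0 : 0 < g by apply: lt_le_trans Tg.
apply: (@le_trans _ _ (B%:R * n%:R)); last by rewrite ler_wpM2l.
apply: (@le_trans _ _ ((1 - v%:R / g) * v%:R)).
  rewrite ler_wpM2r // lerB // ler_wpM2l // lef_pV2 ?posrE //.
rewrite -(ler_pM2l g0).
have -> : g * ((1 - v%:R / g) * v%:R) = g * v%:R - v%:R * v%:R.
  by field; rewrite gt_eqF.
by rewrite lerBlDr addrC [B%:R * _]mulrC.
Qed.

Lemma growth0 (Gamma : groupType) (S : {fset Gamma}) : growth S 0 = 1%N.
Proof.
rewrite /growth (_ : word_ball S 0 = [set 1%g]) ?fset_set1 ?cardfs1 //.
apply/seteqP; split=> [x [[|s w] [//= _ _ ->]]|x ->].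
  by rewrite big_nil.
by exists [::]; split=> //; rewrite big_nil.
Qed.

(** * The function lambda *)

(** The intermediate value theorem for [w * expR w] on a segment ending at [-1],
    where the value is [- expR (-1)]. *)
Lemma lambertWm1P (R : realType) (x : R) : - expR (-1) <= x < 0 ->
  lambertWm1 x <= -1 /\ lambertWm1 x * expR (lambertWm1 x) = x.
Proof.
move=> /andP[xe x0].
suff [w [w1 wx]] : exists w : R, w <= -1 /\ w * expR w = x.
  by rewrite /lambertWm1; case: xgetP => [_ -> []//|/(_ w)[]].
pose z := - x; have z0 : 0 < z by rewrite oppr_gt0.
have z1 : z <= expR (-1) by rewrite lerNl.
have z2 : z < 1 by apply: le_lt_trans z1 _; rewrite expR_lt1; lra.
have M1 : 2 <= 2 / z by rewrite ler_pdivlMr //; nra.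
(* [expR M >= 1 + M ^+ 2 / 2] and [M * z = 2] force [M * expR (- M) <= z]. *)
set M := 2 / z in M1.
have MzE : M * z = 2 by rewrite /M divfK // gt_eqF.
have fM : x <= - M * expR (- M).
  rewrite -[x]opprK -/z mulNr lerN2 expRN ler_pdivrMr ?expR_gt0 //.
  have : 1 + M ^+ 2 / 2 <= expR M by apply: (expR_ge1Dxn 1); lra.
  nra.
have cf : {within `[- M, -1], continuous (fun w : R => w * expR w)}.
  apply: continuous_subspaceT => w.
  by apply: cvgM; [exact: cvg_id|exact: continuous_expR].
have xI : Num.min (- M * expR (- M)) (-1 * expR (-1)) <= x
    <= Num.max (- M * expR (- M)) (-1 * expR (-1)).
  by rewrite ge_min le_max fM mulN1r xe orbT.
have [|w wI wx] := IVT _ cf xI; first by lra.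
by exists w; split => //; move: wI; rewrite in_itv /= => /andP[].
Qed.

(** The inequality [1 + x <= expR x] at [alpha^-1 - 1] puts the argument of the
    Lambert function in its domain.  The branch only yields [alpha <= l]; to
    reach [1 < l], note that [l * expR ((1 - l) / alpha)] is at least [1] for
    [alpha <= l <= 1], while the equation says that it equals [C / v < 1]. *)
Lemma lambda_ofP (R : realType) (C alpha v : R) :
  0 < C -> 0 < alpha -> alpha <= 1 -> C < v ->
  let l := lambda_of C alpha v in
  1 < l /\ l * v = C * expR ((l - 1) / alpha).
Proof.
move=> C0 a0 a1 Cv; have v0 : 0 < v by exact: lt_trans Cv.
have aV : alpha * alpha^-1 = 1 by rewrite mulfV // gt_eqF.
have av0 : 0 < alpha * v by rewrite mulr_gt0.
set x := - (C * expR (- alpha^-1) / (alpha * v)).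
have [W1 WE] : lambertWm1 x <= -1 /\ lambertWm1 x * expR (lambertWm1 x) = x.
  apply: lambertWm1P; rewrite lerN2 oppr_lt0; apply/andP; split; last first.
    by rewrite divr_gt0 // mulr_gt0 // expR_gt0.
  rewrite ler_pdivrMr // [leRHS]mulrC.
  have -> : - alpha^-1 = (-1) - (alpha^-1 - 1) by ring.
  rewrite expRB mulrA ler_pdivrMr ?expR_gt0 //.
  rewrite [leLHS]mulrC -mulrA [leRHS]mulrCA.
  rewrite ler_pM2l ?expR_gt0 //.
  have : alpha^-1 <= expR (alpha^-1 - 1).
    by apply: le_trans (expR_ge1Dx _); rewrite addrC subrK.
  rewrite -(ler_pM2l av0) [leLHS]mulrAC aV mul1r; lra.
rewrite /lambda_of -/x; set W := lambertWm1 x in W1 WE *.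
set l := - alpha * W.
have al : alpha <= l by rewrite /l; nra.
have l0 : 0 < l by exact: lt_le_trans al.
have lv : l * v = C * expR ((l - 1) / alpha).
  have -> : (l - 1) / alpha = - alpha^-1 - W.
    by rewrite /l; field; rewrite gt_eqF.
  rewrite expRB mulrA.
  have eW : expR W != 0 by rewrite gt_eqF // expR_gt0.
  apply: (canRL (mulfK eW)).
  transitivity (- (alpha * v) * (W * expR W)); first by rewrite /l; ring.
  by rewrite WE /x; field; rewrite !gt_eqF.
split=> //; rewrite ltNge; apply/negP => l1.
have := expR_ge1Dx ((1 - l) / alpha).
set E := expR ((1 - l) / alpha) => E1.
have lE : 1 <= l * E.
  apply: (@le_trans _ _ (l * (1 + (1 - l) / alpha))); last by rewrite ler_pM2l.
  rewrite -subr_ge0.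
  have -> : l * (1 + (1 - l) / alpha) - 1 = (1 - l) * (l - alpha) / alpha.
    by field; rewrite gt_eqF.
  by rewrite divr_ge0 ?mulr_ge0 ?subr_ge0 // ltW.
have E0 : 0 < E by exact: expR_gt0.
have lEv : l * E * v = C.
  have EN : expR ((l - 1) / alpha) = E^-1 by rewrite -expRN -mulNr opprB.
  by rewrite mulrAC lv EN divfK // gt_eqF.
by move: Cv; rewrite -lEv -subr_lt0; nra.
Qed.

(** * The isoperimetric inequalities *)

(** The radius maximising [(1 - v / (C * r `^ d)) / r] is the one with
    [C * r `^ d = (d + 1) * v]. *)
Lemma growth_poly_boundary (R : realType) (Gamma : groupType) (S : {fset Gamma})
    (C d : R) : 0 < C -> 1 <= d ->
  (forall n : nat, (1 <= n)%N -> C * n%:R `^ d <= (growth S (n - 1))%:R) ->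
  forall D : {fset Gamma}, D != fset0 ->
    C `^ (1 / d) * d / (d + 1) `^ ((d + 1) / d)
      * (#|` D|)%:R `^ ((d - 1) / d) <= (#|` boundary S D|)%:R.
Proof.
move=> C0 d1 gS D D0.
have d0 : 0 < d by lra.
have dn0 : d != 0 by rewrite gt_eqF.
have e0 : 0 < d + 1 by lra.
set v : R := #|` D|%:R.
have v0 : 0 < v by rewrite ltr0n cardfs_gt0.
pose r := ((d + 1) * v / C) `^ (1 / d).
have r0 : 0 < r by rewrite powR_gt0 // divr_gt0 // mulr_gt0.
have rd : C * r `^ d = (d + 1) * v.
  rewrite /r -powRrM div1r mulVf // powRr1; last first.
    by rewrite ltW // divr_gt0 // mulr_gt0.
  by rewrite mulrC divfK // gt_eqF.
have Tg : (d + 1) * v <= (growth S (Num.truncn r))%:R.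
  rewrite -rd; have := gS (Num.truncn r).+1 isT; rewrite subn1; apply: le_trans.
  rewrite ler_pM2l // ge0_ler_powR ?nnegrE ?ltW //.
  exact: truncnS_gt.
have T0 : 0 < (d + 1) * v by rewrite mulr_gt0.
apply: le_trans (boundary_radius D r0 T0 Tg); rewrite -/v.
have -> : (d + 1) / d = 1 + 1 / d by field.
have -> : (d - 1) / d = 1 - 1 / d by field.
rewrite powRD; last by rewrite (gt_eqF e0) implybT.
rewrite powRB; last by rewrite (gt_eqF v0) implybT.
have [v0' C0' e0'] : [/\ 0 <= v, 0 <= C & 0 <= d + 1] by rewrite !ltW.
rewrite !powRr1 // /r powRM ?mulr_ge0 ?invr_ge0 // powRM //.
rewrite -[C^-1]powR_inv1 // -powRrM mulN1r powRN.
rewrite le_eqVlt; apply/predU1l.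
have c0 : C `^ (1 / d) != 0 by rewrite gt_eqF // powR_gt0.
have c1 : v `^ (1 / d) != 0 by rewrite gt_eqF // powR_gt0.
have c2 : (d + 1) `^ (1 / d) != 0 by rewrite gt_eqF // powR_gt0.
field.
by rewrite c0 c1 c2 !gt_eqF.
Qed.

(** The factor of [#|D|] in the claimed bound is [(1 - 1 / l) / r] for the
    radius [r] at which the lower bound on growth equals [l * v].  The
    hypothesis at [n = 1] gives [C < 1], whence [C < v]. *)
Lemma growth_exp_boundary (R : realType) (Gamma : groupType) (S : {fset Gamma})
    (C b alpha : R) : 0 < C -> 0 < b -> 0 < alpha -> alpha <= 1 ->
  (forall n : nat, (1 <= n)%N ->
     C * expR (b * n%:R `^ alpha) <= (growth S (n - 1))%:R) ->
  forall D : {fset Gamma}, (2 <= #|` D|)%N ->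
    mu_of C alpha (#|` D|)%:R *
      ((#|` D|)%:R / (1 / b * ln (#|` D|)%:R) `^ (1 / alpha))
    <= (#|` boundary S D|)%:R.
Proof.
move=> C0 b0 a0 a1 gS D D2.
set v : R := #|` D|%:R.
have v2 : 2 <= v by rewrite ler_nat.
have v0 : 0 < v by lra.
have an0 : alpha != 0 by rewrite gt_eqF.
have Cv : C < v.
  have := gS 1%N isT; rewrite growth0 powR1 mulr1 => Cb.
  have b1 : 1 < expR b by rewrite expR_gt1.
  suff : C <= 1 by lra.
  apply: le_trans Cb; nra.
have [] := lambda_ofP C0 a0 a1 Cv.
rewrite /mu_of; move: (lambda_of C alpha v) => l l1 lv.
have l0 : 0 < l by lra.
have lnv : 0 < ln v by apply: ln_gt0; lra.
(* [t] is [r `^ alpha], in the shape in which [mu_of] presents it. *)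
pose t := ln v / b * (1 + (ln l - ln C) / ln v).
have tE : b * t = (l - 1) / alpha.
  rewrite -[RHS]expRK.
  have -> : expR ((l - 1) / alpha) = l * v / C.
    by rewrite lv [C * _]mulrC mulfK // gt_eqF.
  rewrite ln_div ?lnM ?posrE ?mulr_gt0 // /t.
  by field; rewrite !gt_eqF.
have t0 : 0 < t.
  by rewrite -(pmulr_rgt0 _ b0) tE divr_gt0 // subr_gt0.
pose r := t `^ (1 / alpha).
have r0 : 0 < r by exact: powR_gt0.
have rT : C * expR (b * r `^ alpha) = l * v.
  by rewrite /r -powRrM div1r mulVf // powRr1 ?ltW // tE lv.
have Tg : l * v <= (growth S (Num.truncn r))%:R.
  rewrite -rT; have := gS (Num.truncn r).+1 isT; rewrite subn1; apply: le_trans.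
  rewrite ler_pM2l // ler_expR ler_pM2l // ge0_ler_powR ?nnegrE ?ltW //.
  exact: truncnS_gt.
have T0 : 0 < l * v by rewrite mulr_gt0.
apply: le_trans (boundary_radius D r0 T0 Tg); rewrite -/v.
have s0 : 0 < 1 + (ln l - ln C) / ln v.
  by rewrite -(pmulr_rgt0 _ (divr_gt0 lnv b0)).
have [lb0 s0'] : 0 <= ln v / b /\ 0 <= 1 + (ln l - ln C) / ln v.
  by rewrite !ltW // divr_gt0.
rewrite /r /t powRM // powRN !div1r [b^-1 * _]mulrC.
rewrite le_eqVlt; apply/predU1l; field.
by rewrite !gt_eqF // powR_gt0 // divr_gt0.
Qed.

(** * The limit of mu *)

Lemma cvg_ln_div (R : realType) : ln x / x @[x --> +oo] --> (0 : R).
Proof.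
apply/cvgr0Pnorm_le => e e0; near=> x.
have x1 : 1 <= x by near: x; exact: nbhs_pinfty_ge.
have x0 : 0 < x by lra.
rewrite ger0_norm; last by rewrite divr_ge0 ?ln_ge0 ?ltW.
rewrite ler_pdivrMr //.
(* [ln x = 2 * ln s < 2 * s <= e * s ^+ 2] as soon as [2 <= e * s]. *)
pose s := Num.sqrt x.
have s0 : 0 < s by rewrite sqrtr_gt0.
have sx : s ^+ 2 = x by rewrite sqr_sqrtr // ltW.
have es : 2 <= e * s.
  rewrite -ler_pdivrMl // mulrC -[leLHS]gtr0_norm ?divr_gt0 // -sqrtr_sqr.
  rewrite ler_wsqrtr //; near: x; apply: nbhs_pinfty_ge; exact: num_real.
rewrite -sx lnXn //.
have := ln_sublinear s0; nra.
Unshelve. all: by end_near. Qed.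

(** From [v <= l * v = C * expR ((l - 1) / alpha)], lambda grows at least
    logarithmically. *)
Lemma cvg_lambda_of (R : realType) (C alpha : R) :
  0 < C -> 0 < alpha -> alpha <= 1 -> lambda_of C alpha v @[v --> +oo] --> +oo.
Proof.
move=> C0 a0 a1; apply/cvgryPge => A; near=> v.
have Cv : C < v by near: v; apply: nbhs_pinfty_gt; exact: num_real.
have [] := lambda_ofP C0 a0 a1 Cv; set l := lambda_of C alpha v => l1 lv.
have vA : C * expR ((A - 1) / alpha) <= v.
  by near: v; apply: nbhs_pinfty_ge; exact: num_real.
have : C * expR ((A - 1) / alpha) <= C * expR ((l - 1) / alpha).
  by apply: le_trans vA _; rewrite -lv; nra.
by rewrite ler_pM2l // ler_expR ler_pM2r ?invr_gt0 // lerD2r.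
Unshelve. all: by end_near. Qed.

Lemma cvg_mu_of (R : realType) (C alpha : R) :
  0 < C -> 0 < alpha -> alpha <= 1 -> mu_of C alpha v @[v --> +oo] --> (1 : R).
Proof.
move=> C0 a0 a1; have lV := cvg_lambda_of C0 a0 a1.
pose l := lambda_of C alpha.
have an0 : alpha != 0 by rewrite gt_eqF.
(* [p v] is, for large [v], the base of the power in [mu_of], with [ln v]
   expressed through [l v] and the fraction reduced by [l v / alpha]. *)
pose q v := 1 - (l v)^-1.
pose p v := q v / (q v - alpha * (ln (l v) / l v) + alpha * ln C * (l v)^-1).
apply: (@cvg_trans _ ((q v * p v `^ (- (1 / alpha))) @[v --> +oo])).
  apply: near_eq_cvg; near=> v.
  have Cv : C < v by near: v; apply: nbhs_pinfty_gt; exact: num_real.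
  have v1 : 1 < v by near: v; apply: nbhs_pinfty_gt; exact: num_real.
  have [] := lambda_ofP C0 a0 a1 Cv; rewrite -/(l v) => l1 lv.
  have l0 : 0 < l v by lra.
  have v0 : 0 < v by lra.
  have lnv : 0 < ln v by apply: ln_gt0.
  have lnE : ln v = (l v - 1) / alpha - ln (l v) + ln C.
    have := congr1 (@ln R) lv.
    by rewrite (lnM l0 v0) lnM ?posrE ?expR_gt0 // expRK; lra.
  have e : ln (l v) - ln C = (l v - 1) / alpha - ln v by rewrite lnE; ring.
  have dE : q v - alpha * (ln (l v) / l v) + alpha * ln C * (l v)^-1
      = alpha * ln v / l v.
    by rewrite /q lnE; field; rewrite gt_eqF.
  rewrite /mu_of -/(l v) div1r -/(q v) e /p dE /q.
  by congr (_ * _ `^ _); field; rewrite !gt_eqF.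
have VI : (l v)^-1 @[v --> +oo] --> (0 : R).
  apply/gtr0_cvgV0 => //; near=> v.
  have Cv : C < v by near: v; apply: nbhs_pinfty_gt; exact: num_real.
  by have [l1 _] := lambda_ofP C0 a0 a1 Cv; apply: lt_trans l1.
have LI : ln (l v) / l v @[v --> +oo] --> (0 : R).
  by apply: (@cvg_comp _ _ _ l (fun x => ln x / x) _ _ _ lV); exact: cvg_ln_div.
have q1 : q v @[v --> +oo] --> (1 : R).
  rewrite -[1]subr0; apply: cvgB => //; exact: cvg_cst.
have p1 : p v @[v --> +oo] --> (1 : R).
  have -> : (1 : R) = 1 / (1 - alpha * 0 + alpha * ln C * 0) by field; lra.
  apply: cvgM => //; apply: cvgV; first by lra.
  by apply: cvgD; [apply: cvgB => //|]; apply: cvgM => //; exact: cvg_cst.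
suff pa1 : p v `^ (- (1 / alpha)) @[v --> +oo] --> (1 : R).
  by have := cvgM q1 pa1; rewrite mulr1; apply.
set s := - (1 / alpha).
have cs : {for (1 : R), continuous (fun a : R => a `^ s)}.
  apply/differentiable_continuous/derivable1_diffP.
  by apply: derivable_powR; rewrite in_itv /= ltr01.
by have := cvg_comp p (fun a : R => a `^ s) p1 cs; rewrite powR1.
Unshelve. all: by end_near. Qed.

Theorem corollary2 (R : realType) (Gamma : groupType) (S : {fset Gamma})
    (Gamma_infinite : infinite_set [set: Gamma])
    (S_sym : symmetric_fset S) (S_gen : generates S) :
  (forall C d : R, 0 < C -> 1 <= d ->
     (forall n : nat, (1 <= n)%N ->
        C * n%:R `^ d <= (growth S (n - 1))%:R) ->
     forall D : {fset Gamma}, D != fset0 ->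
       C `^ (1 / d) * d / (d + 1) `^ ((d + 1) / d)
         * (#|` D|)%:R `^ ((d - 1) / d)
       <= (#|` boundary S D|)%:R)
  /\
  (forall C b alpha : R, 0 < C -> 0 < b -> 0 < alpha -> alpha <= 1 ->
     (forall n : nat, (1 <= n)%N ->
        C * expR (b * n%:R `^ alpha) <= (growth S (n - 1))%:R) ->
     (forall D : {fset Gamma}, (2 <= #|` D|)%N ->
        mu_of C alpha (#|` D|)%:R *
          ((#|` D|)%:R / (1 / b * ln (#|` D|)%:R) `^ (1 / alpha))
        <= (#|` boundary S D|)%:R)
     /\ mu_of C alpha v @[v --> +oo] --> (1 : R)).
Proof.
split; first exact: growth_poly_boundary.
move=> C b alpha C0 b0 a0 a1 gS; split; first exact: growth_exp_boundary.
exact: cvg_mu_of.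
Qed.
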